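(* For all $\beta \in (\sqrt{5}-1,2)$, there exists a constant $c_\beta \in (0, \infty)$ such that for all smooth $f \colon [0,\infty) \to [0,\infty)$ with $f(0)=0$ the following inequality holds: $$ \log \int_0^\infty e^{|f(x)|^\frac{2\beta}{\beta+2}} e^{-\frac{x^2}{2}} dx \leq \left(\int_0^\infty e^{ |\kappa f'(x)|^\beta} e^{-\frac{x^2}{2}} dx \right)^\frac{2\beta}{\beta+2} + c_\beta , \qquad \kappa= \frac{\sqrt{2}\,\beta}{\beta+2}. $$ One can take $$ c_\beta = \frac{5}{(2-\beta)^2} - \log(\beta-\sqrt{5}+1). $$
   Context: The right-hand side may be $+\infty$, in which case the inequality is trivial. *)

(* Defs.v *)
From HB Require Import structures.
From mathcomp Require Import all_boot all_order all_algebra.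
From mathcomp Require Import all_classical all_reals all_analysis.

Set Implicit Arguments.
Unset Strict Implicit.
Unset Printing Implicit Defensive.
Import Order.TTheory GRing.Theory Num.Theory.
Import numFieldNormedType.Exports.

Local Open Scope classical_set_scope.
Local Open Scope ring_scope.

(* A function on [0, +oo[ is represented by a total function R -> R of which
   only the values on [0, +oo[ are used: difference quotients are restricted to
   [0, +oo[, so the derivative is one-sided at 0 and two-sided elsewhere. *)
Definition halfline_quotient {R : realType} (f : R -> R) (x : R) : set_system R :=
  (f y - f x) / (y - x) @[y --> within `[0, +oo[ x^'].

Definition halfline_derivable {R : realType} (f : R -> R) (x : R) : Prop :=
  cvg (halfline_quotient f x).

Definition halfline_derive {R : realType} (f : R -> R) (x : R) : R :=
  lim (halfline_quotient f x).

Definition halfline_smooth {R : realType} (f : R -> R) : Prop :=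
  forall (n : nat) (x : R), 0 <= x ->
    halfline_derivable (iter n halfline_derive f) x.

(* The integral of g over [0, +oo[ against the unnormalized Gaussian weight;
   it takes values in \bar R and may be +oo. *)
Definition gauss_integral {R : realType} (g : R -> R) : \bar R :=
  (\int[lebesgue_measure]_(x in `[0%R, +oo[)
     (g x * expR (- (x ^+ 2 / 2)))%:E)%E.

Definition kappa {R : realType} (beta : R) : R :=
  Num.sqrt 2 * beta / (beta + 2).

(* lne and poweR extend ln and powR to \bar R, with value +oo at +oo (for a
   nonzero exponent), so the inequality holds trivially when its right-hand
   side is +oo. *)
Definition exp_integrability_ineq {R : realType} (beta c : R) (f : R -> R)
    : Prop :=
  (lne (gauss_integral
          (fun x => expR (`|f x| `^ (2 * beta / (beta + 2)))%R))
   <= poweR (gauss_integral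
          (fun x => expR (`|kappa beta * halfline_derive f x| `^ beta)%R))
        (2 * beta / (beta + 2))%R
      + c%:E)%E.

Definition admissible_constant {R : realType} (beta c : R) : Prop :=
  0 < c /\
  forall f : R -> R,
    halfline_smooth f -> (forall x : R, 0 <= x -> 0 <= f x) -> f 0 = 0 ->
    exp_integrability_ineq beta c f.

(* Main.v *)
Require Import Defs.
From mathcomp Require Import all_boot all_order all_algebra.
From mathcomp Require Import all_classical all_reals all_analysis.
From mathcomp Require Import measurable_realfun ring lra.
Import Order.TTheory GRing.Theory Num.Theory.
Import numFieldNormedType.Exports.
Local Open Scope classical_set_scope.
Local Open Scope ring_scope.

(** Write [a = 2 / beta - 1], so that [beta = 2 / (1 + a)], the outer
    exponent is [2 / (2 + a)] and [kappa = sqrt 2 / (2 + a)]; let [A] be the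
    integral on the right-hand side and [phi = |kappa f'|^beta - t^2/2], so
    [A] is the integral of [exp phi].  By concavity [|kappa f'| = (t^2/2 +
    phi)^(1/beta)] lies below its tangent at [phi = 0], which is linear in
    [phi] with weight a multiple of [t^(a - 1)].  The duality [phi <= exp
    (phi - c) + c - 1], with [c(t)] chosen so that [exp (- c)] cancels this
    weight, bounds the integral of the weighted [phi] over [0, X] by [A] and
    an explicit function of [X].  This gives [f(x)^(2 / (2 + a)) <= X^2/2 +
    C (ln A - ln X + (1 - a)^2 / a)] for all [x <= X], with [C = (1 + a) / a
    >= 2].  Taking [X = max(x, 1)] makes the left-hand integrand at most a
    multiple of [1 / (1 + x^2)]; finally [C ln A <= A^(2 / (2 + a)) + const]
    because a logarithm is dominated by a linear function. *)

(** * Tangent-line and exponential inequalities at a point *)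

(** Young's inequality for the product of z^g and 1, with conjugate exponents 1/g and 1/(1-g). The
    right-hand side is the tangent of the concave power at z = 1. *)
Lemma powR_le_affine (R : realType) (z g : R) :
  0 <= z -> 0 < g < 1 -> z `^ g <= g * z + (1 - g).
Proof.
move=> z0 /andP[g0 g1].
have g1' : 0 < 1 - g by lra.
have /= := @conjugate_powR R (z `^ g) 1 g^-1 (1 - g)^-1.
rewrite powR_ge0 ler01 !invr_gt0 g0 g1' !invrK -powRrM mulfV ?gt_eqF//.
rewrite powRr1// powR1 mulr1 mul1r [z * g]mulrC; apply => //; lra.
Qed.

(** Used with u = |kappa f'(t)|. Writing w = u^(2/(1+a)), the affine bound is applied to the ratio
    of w to t^2/2, so the point of tangency is w = t^2/2, where phi = 0. *)
Lemma le_powR_tangent (R : realType) (a t u : R) :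
  0 < a < 1 -> 0 < t -> 0 <= u ->
  u <= 2 `^ (- ((1 + a) / 2)) *
    (t `^ (1 + a) +
     (1 + a) * (t `^ (a - 1) * (u `^ (2 / (1 + a)) - t ^+ 2 / 2))).
Proof.
move=> /andP[a0 a1] t0 u0.
set g := (1 + a) / 2; set w := u `^ _.
have q0 : 0 < t ^+ 2 / 2 by rewrite divr_gt0// exprn_gt0.
have w0 : 0 <= w by exact: powR_ge0.
have uE : u = (w / (t ^+ 2 / 2)) `^ g * (t ^+ 2 / 2) `^ g.
  rewrite -(powRM _ (divr_ge0 w0 (ltW q0)) (ltW q0)) divfK ?gt_eqF// /w -powRrM.
  have -> : 2 / (1 + a) * g = 1 by rewrite /g; field; lra.
  by rewrite powRr1.
rewrite {1}uE.
have -> : (t ^+ 2 / 2) `^ g = 2 `^ (- g) * t `^ (1 + a).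
  rewrite powRM ?exprn_ge0 ?invr_ge0 ?(ltW t0)// mulrC -powR_inv1// -powRrM.
  rewrite mulN1r -powR_mulrn ?(ltW t0)// -powRrM; congr (_ * t `^ _).
  by rewrite /g; lra.
rewrite mulrCA ler_pM2l ?powR_gt0//.
have -> : t `^ (a - 1) = t `^ (1 + a) / t ^+ 2.
  rewrite -powR_mulrn ?(ltW t0)// -powRN -powRD ?(gt_eqF t0) ?implybT//.
  by congr (_ `^ _); ring.
have tp : 0 < t `^ (1 + a) by exact: powR_gt0.
apply: le_trans (_ : (g * (w / (t ^+ 2 / 2)) + (1 - g)) * t `^ (1 + a) <= _).
  rewrite ler_pM2r//; apply: powR_le_affine; first by rewrite divr_ge0// ltW.
  by rewrite /g; lra.
rewrite le_eqVlt; apply/orP; left; apply/eqP; rewrite /g; field.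
by rewrite gt_eqF.
Qed.

(* [1 + y <= expR y] at [y = x - c], where [expR c = K * t `^ (a - 1)]. *)
Lemma le_expR_div (R : realType) (a t x K : R) : 0 < t -> 0 < K ->
  t `^ (a - 1) * x <=
  expR x / K + t `^ (a - 1) * (ln K - 1 - (1 - a) * ln t).
Proof.
move=> t0 K0.
have tp : 0 < t `^ (a - 1) by exact: powR_gt0.
have := expR_ge1Dx (x - (a - 1) * ln t - ln K).
rewrite !expRD !expRN lnK ?posrE// (mulrC (a - 1)) -/(powR _ _).
have -> : expR (ln t * (a - 1)) = t `^ (a - 1).
  by rewrite /powR gt_eqF// mulrC.
rewrite -(ler_pM2l tp) => h.
rewrite -lerBlDr; apply: le_trans (le_trans h _).
  by rewrite le_eqVlt; apply/orP; left; apply/eqP; ring.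
by rewrite le_eqVlt; apply/orP; left; apply/eqP; field; lra.
Qed.

(** * From the integrated majorant to a bound on a power of f *)

(** An explicit primitive of the part of the majorant that is free of f. The term over a^2 is the
    correction from integrating s^(a-1) ln s by parts. *)
Lemma is_derive_growth_primitive (R : realType) (a c t : R) : 0 < a -> 0 < t ->
  is_derive t 1 (fun s : R => s `^ (2 + a) / (2 + a)
      + (1 + a) * (s `^ a / a * (c - (1 - a) * ln s)
                   + (1 - a) * s `^ a / a ^+ 2))
    (t `^ (1 + a) + (1 + a) * (t `^ (a - 1) * (c - (1 - a) * ln t))).
Proof.
move=> a0 t0.
have d1 := is_derive1_powR (2 + a) t0.
have d2 := is_derive1_powR a t0.
have d3 := is_derive1_ln t0.
apply: is_derive_eq.
rewrite /=.
have -> : t `^ (a - 1) = t `^ a / t.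
  by rewrite powRB ?powRr1 ?(ltW t0)// (gt_eqF t0) implybT.
have -> : 2 + a - 1 = 1 + a by ring.
rewrite /GRing.scale/=.
field; lra.
Qed.

Lemma powR_le_of_growth (R : realType) (a X v L : R) :
  0 < a -> 0 < X -> 0 <= v ->
  Num.sqrt 2 / (2 + a) * v <= 2 `^ (- ((1 + a) / 2)) *
    (X `^ (2 + a) / (2 + a) + (1 + a) / a * X `^ a * L) ->
  v `^ (2 / (2 + a)) <= X ^+ 2 / 2 + (1 + a) / a * L.
Proof.
move=> a0 X0 v0 le_v.
(* [S] is the value of v at which v^(2/(2+a)) equals X^2/2. The concave power is again replaced by
   its tangent, now at v/S = 1. *)
set S := 2 `^ (- ((2 + a) / 2)) * X `^ (2 + a).
have S0 : 0 < S by rewrite mulr_gt0 ?powR_gt0.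
have SE : S `^ (2 / (2 + a)) = X ^+ 2 / 2.
  rewrite powRM ?powR_ge0// -!powRrM mulrC; congr (_ * _).
    rewrite -powR_mulrn ?(ltW X0)//; congr (_ `^ _); field; lra.
  rewrite -[RHS]powR_inv1//; congr (_ `^ _); field; lra.
have vS : v / S <= 1 + (2 + a) * (1 + a) / a * L / X ^+ 2.
  rewrite ler_pdivrMr// /S.
  have -> : 2 `^ (- ((2 + a) / 2)) = 2 `^ (- ((1 + a) / 2)) / Num.sqrt 2 :> R.
    rewrite -powR12_sqrt// -powRN -powRD ?pnatr_eq0 ?implybT//.
    by congr (_ `^ _); field.
  have s2 : 0 < Num.sqrt 2 :> R by rewrite sqrtr_gt0.
  have s3 : 0 < Num.sqrt 2 / (2 + a) by rewrite divr_gt0//; lra.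
  rewrite -(ler_pM2l s3); apply: le_trans le_v _.
  have -> : X `^ (2 + a) = X ^+ 2 * X `^ a.
    by rewrite powRD ?(gt_eqF X0) ?implybT// powR_mulrn// ltW.
  rewrite le_eqVlt; apply/orP; left; apply/eqP; field.
  by rewrite ?gt_eqF//; lra.
have -> : v `^ (2 / (2 + a)) = (v / S) `^ (2 / (2 + a)) * (X ^+ 2 / 2).
  by rewrite -SE -(powRM _ (divr_ge0 v0 (ltW S0)) (ltW S0)) divfK ?gt_eqF.
have q0 : 0 < X ^+ 2 / 2 by rewrite divr_gt0// exprn_gt0.
have g01 : 0 < 2 / (2 + a) < 1.
  by rewrite divr_gt0/= ?ltr_pdivrMr; lra.
have h := powR_le_affine R (v / S) (2 / (2 + a)) (divr_ge0 v0 (ltW S0)) g01.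
rewrite -(ler_pM2r q0) in h; apply: le_trans h _.
have gq : 0 < 2 / (2 + a) * (X ^+ 2 / 2) by rewrite mulr_gt0//; case/andP: g01.
rewrite -(ler_pM2l gq) in vS.
apply: le_trans (_ : 2 / (2 + a) * (X ^+ 2 / 2) *
   (1 + (2 + a) * (1 + a) / a * L / X ^+ 2)
   + (1 - 2 / (2 + a)) * (X ^+ 2 / 2) <= _).
  by lra.
rewrite le_eqVlt; apply/orP; left; apply/eqP; field.
by rewrite ?gt_eqF//; lra.
Qed.

(** * Logarithm estimates and the numerical constant *)

Lemma ln_le_sub1 (R : realType) (z : R) : 0 < z -> ln z <= z - 1.
Proof.
by move=> z0; have := @le_ln1Dx R (z - 1); rewrite subrKC; apply; lra.
Qed.

Lemma mul_ln_le (R : realType) (y B : R) : 0 < y -> 0 < B ->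
  y * ln B <= B + y ^+ 2 / 8 + y.
Proof.
move=> y0 B0.
have ln2 : ln 2 <= 1 :> R by apply: le_trans (ln_le_sub1 _ _ _) _ => //; lra.
have ln8 : ln 8 <= 3 :> R.
  have -> : 8 = 2 ^+ 3 :> R by ring.
  by rewrite lnXn//; lra.
(* After multiplication by [y], the first term yields [B] and the second y^2/8. The scale 8 keeps
   the quadratic coefficient small enough for the final constant. *)
have -> : ln B = ln (B / y) + ln (y / 8) + ln 8.
  by rewrite !ln_div ?posrE//; ring.
have h1 : ln (B / y) <= B / y - 1 by rewrite ln_le_sub1// divr_gt0.
have h2 : ln (y / 8) <= y / 8 - 1 by rewrite ln_le_sub1// divr_gt0.
apply: le_trans (_ : y * (B / y - 1 + (y / 8 - 1) + 3) <= _).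
  by rewrite ler_pM2l//; lra.
rewrite le_eqVlt; apply/orP; left; apply/eqP; field.
by rewrite gt_eqF.
Qed.

(** Absorbs the logarithm of the left-hand bound into the right-hand side; the last term is
    5/(2-beta)^2 rewritten in [a]. *)
Lemma ln_constant_le (R : realType) (a A : R) :
  0 < a -> a <= 31 / 50 -> 0 < A ->
  ln 4 + ((1 + a) / a * (ln A + (1 - a) ^+ 2 / a) + 1 / 2) <=
  A `^ (2 / (2 + a)) + 5 * (1 + a) ^+ 2 / (4 * a ^+ 2).
Proof.
move=> a0 a1 A0.
have ln4 : ln 4 <= 2 :> R.
  have -> : 4 = 2 ^+ 2 :> R by ring.
  by rewrite lnXn//; have := ln_le_sub1 R 2 (ltr0n _ 2); lra.
(* Chosen so that [y] times the logarithm of A^(2/(2+a)) is (1+a)/a times ln A. *)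
set y := (1 + a) * (2 + a) / (2 * a).
have y0 : 0 < y by rewrite divr_gt0// mulr_gt0//; lra.
have := mul_ln_le _ _ _ y0 (powR_gt0 (2 / (2 + a)) A0).
rewrite ln_powR => h.
have e1 : y * (2 / (2 + a) * ln A) = (1 + a) / a * ln A.
  by rewrite /y; field; lra.
rewrite e1 in h.
have p : y ^+ 2 / 8 + y + (1 + a) / a * ((1 - a) ^+ 2 / a) + 5 / 2 <=
   5 * (1 + a) ^+ 2 / (4 * a ^+ 2).
  rewrite -subr_ge0.
  (* The inner cubic decreases for a >= 0 and is still positive at a = 31/50. *)
  have -> : 5 * (1 + a) ^+ 2 / (4 * a ^+ 2) -
    (y ^+ 2 / 8 + y + (1 + a) / a * ((1 - a) ^+ 2 / a) + 5 / 2) =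
    (4 + a * (68 - 69 * a - 54 * a ^+ 2 - a ^+ 3)) / (32 * a ^+ 2).
    by rewrite /y; field; lra.
  have a2 : a ^+ 2 <= (31 / 50) ^+ 2.
    by rewrite lerXn2r ?nnegrE ?(ltW a0)// divr_ge0.
  have a3 : a ^+ 3 <= (31 / 50) ^+ 3.
    by rewrite lerXn2r ?nnegrE ?(ltW a0)// divr_ge0.
  apply: divr_ge0; last by rewrite mulr_ge0// sqr_ge0.
  by apply: addr_ge0 => //; apply: mulr_ge0; lra.
lra.
Qed.

(** * Calculus on the half-line *)

(** Values at negative arguments are arbitrary, so two-sided continuity is only available at
    positive points; the endpoint 0 is split off as a singleton. *)
Lemma measurable_fun_halfline (R : realType) (g : R -> R) :
  (forall t : R, 0 < t -> {for t, continuous g}) ->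
  measurable_fun (`[0, +oo[ : set R) g.
Proof.
move=> cg; rewrite -(@setU1itv _ _ _ _ false)// measurable_funU//; split.
  exact: measurable_fun_set1.
apply: open_continuous_measurable_fun => [|t]; first exact: interval_open.
by rewrite inE/= in_itv/= andbT; exact: cg.
Qed.

Lemma le_of_is_derive_ge0 (R : realType) (g dg : R -> R) (s t : R) :
  (forall u : R, 0 < u -> is_derive u 1 g (dg u)) ->
  (forall u : R, 0 < u -> 0 <= dg u) -> 0 < s -> s <= t -> g s <= g t.
Proof.
move=> gdg dg0 s0 st.
have pos u : u \in `[s, t] -> 0 < u.
  by rewrite in_itv/= => /andP[su _]; exact: lt_le_trans su.
have [||u /pos u0 E] := @MVT_segment R g dg s t st.
- by move=> u ust; apply: gdg; apply: pos; exact: subset_itv_oo_cc.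
- by apply: derivable_within_continuous => u /pos/gdg; case.
- by rewrite -subr_ge0 E mulr_ge0 ?subr_ge0// dg0.
Qed.

Lemma primitive_halfline (R : realType) (E : R -> R) (A : R) :
  (forall t, 0 <= E t) -> (forall t : R, 0 < t -> {for t, continuous E}) ->
  (\int[lebesgue_measure]_(x in `[0%R, +oo[) (E x)%:E <= A%:E)%E ->
  exists2 G : R -> R, forall t : R, 0 < t -> is_derive t 1 G (E t) &
    forall t, 0 <= G t <= A.
Proof.
move=> E0 cE EA.
have mE := measurable_fun_halfline _ _ cE.
have mE' : measurable_fun (`[0, +oo[ : set R) (EFin \o E).
  exact/measurable_EFinP.
have iE : lebesgue_measure.-integrable `[0, +oo[ (EFin \o E).
  apply/integrableP; split=> //.
  under eq_integral do rewrite /= ger0_norm//.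
  exact: le_lt_trans EA (ltry _).
have sub t : `[0, t] `<=` (`[0, +oo[ : set R).
  by move=> x /=; rewrite !in_itv/= => /andP[-> _].
exists (fun t => \int[lebesgue_measure]_(x in `[0, t]) E x)%R => [t t0|t].
  have [||||d e] := @continuous_FTC1_closed R E 0 t (t + 1).
  - by rewrite ltrDl.
  - exact: integrableS iE.
  - exact: t0.
  - exact: cE.
  - by rewrite -e derive1E; exact: derivableP.
have le : (\int[lebesgue_measure]_(x in `[0%R, t]) (E x)%:E <= A%:E)%E.
  by apply: le_trans EA; apply: ge0_subset_integral => // x _; rewrite lee_fin.
have ge : (0 <= \int[lebesgue_measure]_(x in `[0%R, t]) (E x)%:E)%E.
  by apply: integral_ge0 => x _; rewrite lee_fin.
rewrite /Rintegral fine_ge0//= -lee_fin fineK// ge0_fin_numE//.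
exact: le_lt_trans le (ltry _).
Qed.

Lemma continuous_powR_norm (R : realType) (p : R) : 0 < p ->
  continuous (fun x : R => `|x| `^ p).
Proof.
(* At 0 the power need not be differentiable, so continuity is checked directly with radius
   e^(1/p). *)
move=> p0 x; have [->|xn0] := eqVneq x 0.
  apply/cvgrPdist_le => e e0.
  rewrite normr0 powR0 ?gt_eqF//.
  have d0 : 0 < e `^ p^-1 by exact: powR_gt0.
  near=> y.
  rewrite sub0r normrN ger0_norm ?powR_ge0//.
  have : `|y| <= e `^ p^-1.
    near: y; apply/nbhs_ballP; exists (e `^ p^-1) => //= y.
    by rewrite /ball/= sub0r normrN => /ltW.
  move=> /(ge0_ler_powR (ltW p0)); rewrite !nnegrE -powRrM mulVf ?gt_eqF//.
  by rewrite powRr1 ?(ltW e0)//; apply => //; exact: powR_ge0.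
have x0 : 0 < `|x| by rewrite normr_gt0.
apply: (@continuous_comp _ _ _ (fun y : R => `|y|) (fun y => y `^ p)).
  exact: norm_continuous.
apply: differentiable_continuous; apply/derivable1_diffP.
by have [] := is_derive1_powR p x0.
Unshelve. all: by end_near. Qed.

Lemma halfline_derivable_is_derive (R : realType) (f : R -> R) (t : R) :
  0 < t -> halfline_derivable f t -> is_derive t 1 f (halfline_derive f t).
Proof.
move=> t0 cf.
have sh : h + t @[h --> (0 : R)^'] --> within `[0, +oo[ t^'.
  move=> P; rewrite /within/= => /nbhs_ballP[e /= e0 eP].
  (* A radius of at most [t] keeps h + t in the half-line, so the restricted quotient agrees with
     the two-sided one. *)
  apply/nbhs_ballP; exists (Num.min e t) => /=; first by rewrite lt_min e0.
  move=> h; rewrite /ball/= sub0r normrN lt_min => /andP[he ht] h0.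
  apply: eP; rewrite /ball/=.
  - by rewrite opprD addrCA subrr addr0 normrN.
  - by rewrite -subr_eq0 addrK.
  - rewrite in_itv/= andbT -lerBlDr sub0r.
    by case: (ler_normlP _ _ (ltW ht)); lra.
have lim : h^-1 *: ((f \o shift t) (h *: 1) - f t) @[h --> (0 : R)^']
    --> halfline_derive f t.
  apply: cvg_trans (cvg_comp _ _ sh cf); apply: near_eq_cvg.
  by near=> h; rewrite /= /GRing.scale/= mulr1 addrK mulrC.
split; first by apply/cvg_ex; exists (halfline_derive f t).
exact/cvg_lim.
Unshelve. all: by end_near. Qed.

Lemma halfline_derivable_cvg0 (R : realType) (f : R -> R) :
  halfline_derivable f 0 -> f t @[t --> 0^'+] --> f 0.
Proof.
move=> cf.
have sh : (0 : R)^'+ `=>` within `[0, +oo[ (0 : R)^'.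
  move=> P; rewrite /within/= => /nbhs_ballP[e /= e0 eP].
  apply/nbhs_ballP; exists e => //= y ye y0.
  by apply: eP => //; rewrite ?gt_eqF// in_itv/= andbT ltW.
have c1 : (f t - f 0) / (t - 0) @[t --> 0^'+] --> halfline_derive f 0.
  by move=> P /cf /sh.
have c2 : t @[t --> (0 : R)^'+] --> (0 : R).
  by apply: cvg_within_filter; exact: cvg_id.
have c3 : (f t - f 0) / (t - 0) * t + f 0 @[t --> 0^'+] --> f 0.
  rewrite -[X in _ --> X]add0r -[X in _ --> X + _](mulr0 (halfline_derive f 0)).
  by apply: cvgD (cvgM c1 c2) _; exact: cvg_cst.
apply: cvg_trans c3; apply: near_eq_cvg.
near=> t.
have t0 : 0 < t by near: t; exact: nbhs_right_gt.
by rewrite /= subr0; field; rewrite gt_eqF.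
Unshelve. all: by end_near. Qed.

(** * Growth estimate for f *)

(** The majorant of |k f'| is integrated by comparing f with an explicit primitive [Q], using
    monotonicity only, so f' itself is never integrated. *)
Lemma halfline_growth (R : realType) (f df : R -> R) (a k A x X : R) :
  0 < a < 1 -> 0 <= k -> 0 < A -> 0 < x -> x <= X ->
  (forall t : R, 0 < t -> is_derive t 1 f (df t)) ->
  (forall t : R, 0 < t -> {for t, continuous df}) ->
  f t @[t --> 0^'+] --> (0 : R) ->
  (\int[lebesgue_measure]_(t in `[0%R, +oo[)
     (expR (`|k * df t| `^ (2 / (1 + a))) * expR (- (t ^+ 2 / 2)))%:E
   <= A%:E)%E ->
  k * f x <= 2 `^ (- ((1 + a) / 2)) *
    (X `^ (2 + a) / (2 + a) +
     (1 + a) / a * X `^ a * (ln A - ln X + (1 - a) ^+ 2 / a)).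
Proof.
move=> /[dup] a01 /andP[a0 a1] k0 A0 x0 xX fdf cdf f0 intA.
have X0 : 0 < X by exact: lt_le_trans xX.
set c := 2 `^ _; have c0 : 0 < c by exact: powR_gt0.
set E := fun t => expR (`|k * df t| `^ (2 / (1 + a))) * expR (- (t ^+ 2 / 2)).
have E0 t : 0 <= E t by rewrite mulr_ge0 ?expR_ge0.
have cE (t : R) : 0 < t -> {for t, continuous E}.
  move=> t0; apply: cvgM.
    apply: continuous_comp; last exact: continuous_expR.
    apply: (@continuous_comp _ _ _ (fun t => k * df t)
      (fun y => `|y| `^ (2 / (1 + a)))).
      by apply: cvgMr; exact: cdf.
    by apply: continuous_powR_norm; rewrite divr_gt0//; lra.
  apply: continuous_comp; last exact: continuous_expR.
  by apply: cvgN; apply: cvgMl; exact: exprn_continuous.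
have [G dG GA] := primitive_halfline R E A E0 cE intA.
(* Up to a factor [a], this minimizes the final bound over [K]; it turns (1+a)/K times [A] into
   (1+a) X^a. *)
set K := A * X `^ (- a).
have K0 : 0 < K by rewrite mulr_gt0// powR_gt0.
set P := fun s : R => s `^ (2 + a) / (2 + a)
  + (1 + a) * (s `^ a / a * (ln K - 1 - (1 - a) * ln s)
               + (1 - a) * s `^ a / a ^+ 2).
set dP := fun t => t `^ (1 + a)
  + (1 + a) * (t `^ (a - 1) * (ln K - 1 - (1 - a) * ln t)).
have dPP (t : R) : 0 < t -> is_derive t 1 P (dP t).
  by move=> t0; exact: is_derive_growth_primitive.
pose Q t := c * (P t + (1 + a) / K * G t).
pose dQ t := c * (dP t + (1 + a) / K * E t).
have dQQ (t : R) : 0 < t -> is_derive t 1 Q (dQ t).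
  move=> t0; have := dPP t t0; have := dG t t0 => ? ?.
  by apply: is_derive_eq; rewrite /GRing.scale/= /dQ; ring.
have le t : 0 < t -> `|k * df t| <= dQ t.
  move=> t0; apply: le_trans (le_powR_tangent R a t _ a01 t0 (normr_ge0 _)) _.
  rewrite ler_pM2l// -/c /dP -addrA lerD2l.
  have -> : (1 + a) / K * E t = (1 + a) * (E t / K) by ring.
  rewrite -mulrDr ler_pM2l; last by lra.
  by rewrite [leRHS]addrC /E -expRD; exact: le_expR_div.
have QX : Q x <= Q X.
  apply: (le_of_is_derive_ge0 _ _ dQ) => // u u0.
  exact: le_trans (normr_ge0 _) (le u u0).
(* Q - k f is nondecreasing because k f' <= Q'. The comparison starts at e > 0, since derivatives
   are controlled only there. *)
have step (e : R) : 0 < e -> e <= x -> k * (f x - f e) <= Q x - Q e.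
  move=> e0 ex.
  have : Q e - k * f e <= Q x - k * f x.
    apply: (le_of_is_derive_ge0 _ (fun t => Q t - k * f t)
      (fun t => dQ t - k * df t)) => // u u0.
      have := dQQ u u0; have := fdf u u0 => ? ?.
      by apply: is_derive_eq; rewrite /GRing.scale/=; ring.
    by rewrite subr_ge0; exact: le_trans (ler_norm _) (le u u0).
  lra.
have QXE : Q X <= c * (X `^ (2 + a) / (2 + a) +
     (1 + a) / a * X `^ a * (ln A - ln X + (1 - a) ^+ 2 / a)).
  rewrite ler_pM2l// /P.
  have -> : ln K = ln A - a * ln X.
    by rewrite lnM ?posrE ?powR_gt0// ln_powR mulNr.
  apply: le_trans (_ : _ <= X `^ (2 + a) / (2 + a)
    + (1 + a) * (X `^ a / a * (ln A - a * ln X - 1 - (1 - a) * ln X)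
                 + (1 - a) * X `^ a / a ^+ 2) + (1 + a) / K * A) _.
    by rewrite lerD2l ler_pM2l ?divr_gt0//; [by have /andP[] := GA X|lra].
  have -> : (1 + a) / K * A = (1 + a) * X `^ a.
    rewrite /K powRN; have := powR_gt0 a X0 => ?; field; lra.
  by rewrite le_eqVlt; apply/orP; left; apply/eqP; field; lra.
apply: le_trans (_ : Q X <= _) => //.
(* The starting point is sent to 0 from the right: k f gets below [e] while [Q] is nonnegative, so
   [step] gives k f(x) <= Q(x) + e. *)
apply/ler_addgt0Pr => e e0.
have : \forall t \near 0^'+, [/\ 0 < t, t <= x, k * f t <= e & 0 <= Q t].
  near=> t.
  have t0 : 0 < t by near: t; exact: nbhs_right_gt.
  split => //.
  - by near: t; exact: nbhs_right_le.
  - near: t; apply: cvgr_le e0.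
    by rewrite -[X in _ --> X](mulr0 k); exact: cvgMr.
  - apply: mulr_ge0; first exact: ltW.
    have /andP[Gt _] := GA t.
    apply: addr_ge0; last by rewrite mulr_ge0// divr_ge0 ?(ltW K0)//; lra.
    have pa : 0 <= t `^ a by exact: powR_ge0.
    have pb : 0 <= t `^ (2 + a) by exact: powR_ge0.
    (* [Q] is nonnegative near 0 because [- ln t] tends to [+oo]; no limit of
       [t `^ a * ln t] is needed. *)
    have lnt : 0 <= ln K - 1 - (1 - a) * ln t.
      rewrite subr_ge0 mulrC -ler_pdivlMr; last by lra.
      rewrite -ler_expR lnK ?posrE//.
      by near: t; apply: nbhs_right_le; exact: expR_gt0.
    apply: addr_ge0; first by rewrite divr_ge0//; lra.
    apply: mulr_ge0; first by lra.
    apply: addr_ge0; first by rewrite mulr_ge0// divr_ge0// ltW.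
    by rewrite divr_ge0 ?mulr_ge0 ?sqr_ge0//; lra.
move=> /filter_ex[t [t0 tx kf Qt]].
have := step t t0 tx; rewrite mulrBr; lra.
Unshelve. all: by end_near.
Qed.

(** * Bounds on Gaussian integrals *)

(** On [0, 1] the integrand is at least exp(-1/2). This makes [A] positive, as needed for ln A. *)
Lemma gauss_integral_gt0 (R : realType) (g : R -> R) :
  measurable_fun (`[0, +oo[ : set R) g -> (forall x, 1 <= g x) ->
  (0 < gauss_integral g)%E.
Proof.
move=> mg g1.
set w := fun x : R => expR (- (x ^+ 2 / 2)).
have mw : measurable_fun (`[0, +oo[ : set R) w.
  apply: measurable_fun_halfline => t _.
  apply: continuous_comp; last exact: continuous_expR.
  by apply: cvgN; apply: cvgMl; exact: exprn_continuous.
have mgw : measurable_fun (`[0, +oo[ : set R) (fun x => (g x * w x)%:E).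
  by apply/measurable_EFinP; exact: measurable_funM.
have gw0 x : (0 <= (g x * w x)%:E)%E.
  by rewrite lee_fin mulr_ge0 ?expR_ge0//; apply: le_trans (g1 x).
have gw (x : R) : 0 <= x <= 1 -> expR (- (1 / 2)) <= g x * w x.
  move=> /andP[x0 x1]; apply: le_trans (_ : 1 * w x <= _).
    by rewrite [leRHS]mul1r ler_expR lerN2 ler_pM2r// expr_le1.
  by rewrite ler_pM2r ?expR_gt0.
have sub : `[0, 1] `<=` (`[0, +oo[ : set R).
  by move=> x /=; rewrite !in_itv/= => /andP[->].
apply: lt_le_trans (_ : \int[lebesgue_measure]_(x in (`[0%R, 1%R] : set R))
  (g x * w x)%:E <= _)%E.
  apply: lt_le_trans (_ : \int[lebesgue_measure]_(x in (`[0%R, 1%R] : set R))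
    (expR (- (1 / 2)))%:E <= _)%E.
    rewrite integral_cst//= lebesgue_measure_itv/= lte_fin ltr01 sube0 mule1.
    by rewrite lte_fin expR_gt0.
  by apply: ge0_le_integral => //; apply: (measurable_funS _ sub mgw).
rewrite /gauss_integral -/w.
by apply: (ge0_subset_integral lebesgue_measure _ _ mgw _ sub).
Qed.

(** The integral of 1/(1+x^2) over the half-line is pi/2 < 2. *)
Lemma oneDsqrV_integral_bound (R : realType) (g : R -> R) (M : R) :
  0 <= M -> measurable_fun (`[0, +oo[ : set R) g -> (forall x, 0 <= g x) ->
  (forall x, 0 <= x -> g x <= M * (2 / (1 + x ^+ 2))) ->
  (\int[lebesgue_measure]_(x in `[0%R, +oo[) (g x)%:E <= (4 * M)%:E)%E.
Proof.
move=> M0 mg g0 gM.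
have mo : measurable_fun (`[0, +oo[ : set R) (fun x : R => (oneDsqr x)^-1).
  by apply: measurable_fun_halfline => t _; exact: continuous_oneDsqrV.
apply: le_trans (_ : \int[lebesgue_measure]_(x in (`[0%R, +oo[ : set R))
  ((2 * M)%:E * ((oneDsqr x)^-1)%:E) <= _)%E.
  apply: ge0_le_integral => //.
  - by move=> x _; rewrite lee_fin.
  - exact/measurable_EFinP.
  - by apply: measurable_funeM; exact/measurable_EFinP.
  - move=> x /=; rewrite in_itv/= andbT => x0.
    rewrite -EFinM lee_fin; apply: le_trans (gM x x0) _.
    by rewrite mulrA (mulrC M).
rewrite ge0_integralZl//.
- rewrite integral0y_oneDsqr -EFinM lee_fin.
  have := @pihalf_lt2 R; nra.
- exact/measurable_EFinP.
- by rewrite lee_fin mulr_ge0.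
Qed.

(** For x > 1 the choice X = x cancels the Gaussian and leaves x^(-C) <= x^(-2). Near 0 that power
    would not be integrable, so [X] is frozen at 1 there. *)
Lemma gauss_envelope_le (R : realType) (C D v x X : R) : 2 <= C ->
  0 <= x -> X = Num.max x 1 ->
  v <= X ^+ 2 / 2 + C * (D - ln X) ->
  expR v * expR (- (x ^+ 2 / 2)) <= expR (C * D + 1 / 2) * (2 / (1 + x ^+ 2)).
Proof.
move=> C2 x0 XE vX.
have px : 0 < 1 + x ^+ 2 by rewrite ltr_pwDl// sqr_ge0.
have [x1|x1] := leP x 1.
  rewrite max_r// in XE; rewrite XE ln1 expr1n subr0 in vX.
  rewrite -expRD -[leLHS]mulr1 ler_pM ?expR_ge0//.
    by rewrite ler_expR; have := sqr_ge0 x; lra.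
  rewrite ler_pdivlMr// mul1r.
  have : x ^+ 2 <= 1 by rewrite expr_le1.
  by lra.
rewrite max_l ?(ltW x1)// in XE; rewrite XE in vX.
have x0' : 0 < x by lra.
apply: le_trans (_ : expR (C * D + 1 / 2) * expR (- (2 * ln x)) <= _).
  rewrite -!expRD ler_expR.
  have : 2 * ln x <= C * ln x by rewrite ler_pM2r// ln_gt0.
  lra.
rewrite ler_pM2l ?expR_gt0// expRN expRM_natl lnK ?posrE//.
rewrite ler_pdivlMr// mulrC ler_pdivrMr ?exprn_gt0//.
have : 1 <= x ^+ 2 by rewrite expr_ge1// ltW.
by lra.
Qed.

(** * The inequality in the parameter [a], then in beta *)

Lemma exp_integrability_halfline (R : realType) (a : R) (f : R -> R) :
  0 < a -> a <= 31 / 50 -> halfline_smooth f ->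
  (forall x : R, 0 <= x -> 0 <= f x) -> f 0 = 0 ->
  (lne (gauss_integral (fun x => expR (`|f x| `^ (2 / (2 + a)))%R))
   <= poweR (gauss_integral
        (fun x => expR (`|Num.sqrt 2 / (2 + a) * halfline_derive f x|
                          `^ (2 / (1 + a)))%R)) (2 / (2 + a))%R
      + (5 * (1 + a) ^+ 2 / (4 * a ^+ 2))%:E)%E.
Proof.
move=> a0 a1 sf f0 f00.
set kap : R := Num.sqrt 2 / (2 + a); set g := 2 / (2 + a); set b := 2 / (1 + a).
have g0 : 0 < g by rewrite divr_gt0//; lra.
have b0 : 0 < b by rewrite divr_gt0//; lra.
have df (t : R) : 0 < t -> is_derive t 1 f (halfline_derive f t).
  move=> t0; apply: halfline_derivable_is_derive => //.
  exact: (sf 0%N t (ltW t0)).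
have cont (h : R -> R) : (forall t : R, 0 < t -> halfline_derivable h t) ->
    forall t : R, 0 < t -> {for t, continuous h}.
  move=> dh t t0; apply: differentiable_continuous; apply/derivable1_diffP.
  by have [] := halfline_derivable_is_derive R h t t0 (dh t t0).
have cf : forall t : R, 0 < t -> {for t, continuous f}.
  by apply: cont => t t0; exact: (sf 0%N t (ltW t0)).
have cdf : forall t : R, 0 < t -> {for t, continuous (halfline_derive f)}.
  by apply: cont => t t0; exact: (sf 1%N t (ltW t0)).
have mexp (h : R -> R) (p : R) : 0 < p ->
    (forall t : R, 0 < t -> {for t, continuous h}) ->
    measurable_fun (`[0, +oo[ : set R) (fun x => expR (`|h x| `^ p)).
  move=> p0 ch; apply: measurable_fun_halfline => t t0.
  apply: continuous_comp; last exact: continuous_expR.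
  apply: (@continuous_comp _ _ _ h (fun y => `|y| `^ p)); first exact: ch.
  exact: continuous_powR_norm.
have ckdf (t : R) : 0 < t ->
    {for t, continuous (fun t => kap * halfline_derive f t)}.
  by move=> t0; apply: cvgMr; exact: cdf.
have exp1 (y p : R) : 1 <= expR (y `^ p) by rewrite -expR0 ler_expR powR_ge0.
have IA0 := gauss_integral_gt0 R _ (mexp _ b b0 ckdf) (fun x => exp1 _ _).
have [Aoo|Afin] := eqVneq
  (gauss_integral (fun x => expR (`|kap * halfline_derive f x| `^ b))) +oo%E.
  by rewrite Aoo poweRyr ?gt_eqF// addye// leey.
set IA := gauss_integral _ in IA0 Afin *.
have IAE : IA = (fine IA)%:E.
  by rewrite fineK// ge0_fin_numE ?ltW// lt_neqAle Afin leey.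
set A := fine IA in IAE; rewrite IAE in IA0 *.
have A0 : 0 < A by rewrite -lte_fin.
rewrite poweR_EFin -EFinD.
set D := ln A + (1 - a) ^+ 2 / a.
set C := (1 + a) / a.
have C2 : 2 <= C by rewrite /C ler_pdivlMr//; lra.
have bound (x X : R) : 0 < x -> x <= X ->
    f x `^ g <= X ^+ 2 / 2 + C * (D - ln X).
  move=> x0 xX; apply: powR_le_of_growth => //.
  - exact: lt_le_trans xX.
  - exact/f0/ltW.
  have -> : D - ln X = ln A - ln X + (1 - a) ^+ 2 / a by rewrite /D; ring.
  apply: (halfline_growth R f (halfline_derive f)) => //.
  - by rewrite a0/=; lra.
  - by rewrite divr_ge0 ?sqrtr_ge0//; lra.
  - rewrite -[X in _ --> X]f00; apply: halfline_derivable_cvg0.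
    exact: (sf 0%N 0).
  - by rewrite -IAE.
(* At x = 0 the left-hand side vanishes, and the right-hand side is nonnegative by the previous
   bound at x = X = 1. *)
have {}bound (x : R) : 0 <= x ->
    `|f x| `^ g <= Num.max x 1 ^+ 2 / 2 + C * (D - ln (Num.max x 1)).
  rewrite le_eqVlt => /predU1P[<-|x0].
    rewrite f00 normr0 powR0 ?gt_eqF// max_r//.
    by apply: le_trans (bound 1 1 ltr01 (lexx _)); exact: powR_ge0.
  rewrite ger0_norm; last exact/f0/ltW.
  by apply: bound; rewrite ?le_max ?lexx.
have LHS : (gauss_integral (fun x => expR (`|f x| `^ g)) <=
            (4 * expR (C * D + 1 / 2))%:E)%E.
  apply: oneDsqrV_integral_bound.
  - exact: expR_ge0.
  - apply: measurable_funM.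
      exact: mexp.
    apply: measurable_fun_halfline => t _.
    apply: continuous_comp; last exact: continuous_expR.
    by apply: cvgN; apply: cvgMl; exact: exprn_continuous.
  - by move=> x; rewrite mulr_ge0 ?expR_ge0.
  - by move=> x x0; apply: gauss_envelope_le (bound x x0).
have LHS0 : (0 <= gauss_integral (fun x => expR (`|f x| `^ g)))%E.
  by apply: integral_ge0 => x _; rewrite lee_fin mulr_ge0 ?expR_ge0.
have M0 : 0 < 4 * expR (C * D + 1 / 2) by rewrite mulr_gt0// expR_gt0.
apply: le_trans (_ : lne (4 * expR (C * D + 1 / 2))%:E <= _)%E.
  by rewrite lee_lne// in_itv/= ?LHS0 ?leey//= lee_fin ltW.
rewrite lne_EFin// lee_fin lnM ?posrE ?expR_gt0// expRK.
exact: ln_constant_le.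
Qed.

Theorem theorem4p4 (R : realType) (beta : R)
    (hbeta1 : Num.sqrt 5 - 1 < beta) (hbeta2 : beta < 2) :
  (exists c : R, admissible_constant beta c) /\
  admissible_constant beta
    (5 / (2 - beta) ^+ 2 - ln (beta - Num.sqrt 5 + 1)).
Proof.
suff adm : admissible_constant beta
    (5 / (2 - beta) ^+ 2 - ln (beta - Num.sqrt 5 + 1)).
  by split => //; exists (5 / (2 - beta) ^+ 2 - ln (beta - Num.sqrt 5 + 1)).
(* Precise enough for a <= 31/50: at beta = sqrt 5 - 1 the parameter [a] is (sqrt 5 - 1)/2, about
   0.618. *)
have s5 : 447 / 200 <= Num.sqrt 5 :> R.
  have q5 : Num.sqrt 5 ^+ 2 = 5 :> R by apply: sqr_sqrtr; lra.
  have := sqrtr_ge0 (5 : R); nra.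
(* The argument is below 3 - sqrt 5 < 1, so subtracting this logarithm can only enlarge the
   constant. *)
have ln0 : ln (beta - Num.sqrt 5 + 1) <= 0 by apply: ln_le0; lra.
have c0 : 0 < 5 / (2 - beta) ^+ 2.
  by rewrite divr_gt0// exprn_gt0//; lra.
split=> [|f sf f0 f00]; first by lra.
set a := 2 / beta - 1.
have a0 : 0 < a by rewrite subr_gt0 ltr_pdivlMr; lra.
have a1 : a <= 31 / 50 by rewrite lerBlDr ler_pdivrMr; lra.
have e1 : 2 / (1 + a) = beta by rewrite /a; field; lra.
have e2 : 2 / (2 + a) = 2 * beta / (beta + 2) by rewrite /a; field; lra.
have e3 : Num.sqrt 2 / (2 + a) = kappa beta by rewrite /a /kappa; field; lra.
have e4 : 5 * (1 + a) ^+ 2 / (4 * a ^+ 2) = 5 / (2 - beta) ^+ 2.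
  by rewrite /a; field; lra.
have := exp_integrability_halfline _ _ _ a0 a1 sf f0 f00.
rewrite e1 e2 e3 e4 => h; apply: le_trans h _.
by rewrite leeD2l// lee_fin; lra.
Qed.
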